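(* Let $X=X_1\times X_2$ and let $d$ be a separable distance on $X$, i.e. $$d(\mathbf{x},\mathbf{y})=d_1(x_1,y_1)+d_2(x_2,y_2)\qquad\text{for all }\mathbf{x}=(x_1,x_2),\ \mathbf{y}=(y_1,y_2)\in X,$$ where $d_1$ is a distance on $X_1$ and $d_2$ is a distance on $X_2$, and $(X,d)$ is a Polish space. Let $\mu,\nu\in\mathcal{P}(X)$. Then for every pivot measure $\zeta$ between $\mu$ and $\nu$ (for the cost $c=d$), $$W_d(\mu,\nu)=W_d(\mu,\zeta)+W_d(\zeta,\nu).$$
   Context: $\mathcal{P}(Z)$ denotes the Borel probability measures on a Polish space $Z$; $T_\#$ denotes push-forward; $\mathfrak{p}_A$ denotes the projection onto the factor(s) $A$. $(X,d)$ being Polish means it is a complete separable metric space. $W_d(\mu,\nu)=\inf_{\pi\in\Pi(\mu,\nu)}\int_{X\times X}d\,d\pi\in[0,+\infty]$, where $\Pi(\mu,\nu)$ is the set of probability measures on $X\times X$ with marginals $\mu$ and $\nu$. Here the target space is $Y=X$, i.e. $Y=Y_1\times Y_2$ with $Y_1=X_1$, $Y_2=X_2$. Cardinal flows: $\mathcal{F}(\mu,\nu)$ is the set of pairs $(f^{(1)},f^{(2)})\in\mathcal{P}(X\times Y_1)\times\mathcal{P}(X_2\times Y)$ such that $(\mathfrak{p}_X)_\#f^{(1)}=\mu$, $(\mathfrak{p}_Y)_\#f^{(2)}=\nu$ and $(\mathfrak{p}_{Y_1\times X_2})_\#f^{(1)}=(\mathfrak{p}_{Y_1\times X_2})_\#f^{(2)}$.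 A cardinal flow is optimal if it minimizes $\int_{X\times Y_1}d_1(x_1,y_1)\,df^{(1)}+\int_{X_2\times Y}d_2(x_2,y_2)\,df^{(2)}$ over $\mathcal{F}(\mu,\nu)$. A measure $\zeta\in\mathcal{P}(Y_1\times X_2)=\mathcal{P}(X_1\times X_2)=\mathcal{P}(X)$ is a pivot measure between $\mu$ and $\nu$ if there is an optimal cardinal flow with $(\mathfrak{p}_{Y_1\times X_2})_\#f^{(1)}=(\mathfrak{p}_{Y_1\times X_2})_\#f^{(2)}=\zeta$. *)

(* Defs.v *)
From HB Require Import structures.
From mathcomp Require Import all_boot all_order all_algebra.
From mathcomp Require Import all_classical all_reals all_analysis.

Set Implicit Arguments.
Unset Strict Implicit.
Unset Printing Implicit Defensive.
Import Order.TTheory GRing.Theory Num.Theory.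

Local Open Scope classical_set_scope.
Local Open Scope ring_scope.

(* The library's measurable types are pointed, hence so are the spaces here; a
   space that carries a probability measure is nonempty anyway. *)
#[short(type="pmetricType")]
HB.structure Definition PMetric (K : numDomainType) :=
  {M of Metric K M & Pointed M}.

Definition polish_metric (R : realType) (T : pmetricType R) : Prop :=
  (exists2 D : set T, countable D & dense D) /\
  (forall F : set_system T, ProperFilter F -> cauchy F -> cvg F).

Notation borel T := (g_sigma_algebraType (@open T)).

(* An alias of X1 * X2, so that it can carry the sum distance: the plain product
   already has the max pseudometric. Other products below keep the library's
   product topology. *)
Definition sum_prod (X1 X2 : Type) : Type := (X1 * X2)%type.

Section sum_prod_metric.
Context {R : realType} {X1 X2 : pmetricType R}.
Local Notation X := (sum_prod X1 X2).

Definition sum_dist (x y : X) : R := mdist x.1 y.1 + mdist x.2 y.2.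

Let sum_distxx x : sum_dist x x = 0.
Proof. by rewrite /sum_dist !mdistxx addr0. Qed.

Let sum_dist_positivity x y : sum_dist x y = 0 -> x = y.
Proof.
case: x y => [x1 x2] [y1 y2] /eqP.
rewrite /sum_dist/= paddr_eq0 ?mdist_ge0// => /andP[/eqP + /eqP].
by move=> /mdist_positivity -> /mdist_positivity ->.
Qed.

Let sum_dist_sym x y : sum_dist x y = sum_dist y x.
Proof. by rewrite /sum_dist metric_sym [X in _ + X]metric_sym. Qed.

Let sum_dist_triangle y x z : sum_dist x z <= sum_dist x y + sum_dist y z.
Proof. by rewrite /sum_dist addrACA lerD// metric_triangle. Qed.

HB.instance Definition _ := Pointed.copy X (X1 * X2)%type.
HB.instance Definition _ := isMetric.Build R X
  sum_distxx sum_dist_positivity sum_dist_sym sum_dist_triangle.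

End sum_prod_metric.

(* Measures of the library are total functions constrained on measurable sets
   only, so image measures are compared on measurable sets. *)
Definition has_image (R : realType) d d'
    (S : measurableType d) (T : measurableType d')
    (m : set S -> \bar R) (f : S -> T) (m' : set T -> \bar R) : Prop :=
  forall A, measurable A -> pushforward m f A = m' A.

Section wasserstein.
Context {R : realType} {T : pmetricType R}.
Implicit Types mu nu : probability (borel T) R.

Definition coupling mu nu : set (probability (borel (T * T)%type) R) :=
  [set pi | has_image pi (fst : borel (T * T)%type -> borel T) mu /\
            has_image pi (snd : borel (T * T)%type -> borel T) nu].

Definition wasserstein mu nu : \bar R :=
  ereal_inf [set (\int[pi]_z (mdist (z : T * T).1 (z : T * T).2)%:E)%E
            | pi in coupling mu nu].

End wasserstein.

Section cardinal_flows.
Context {R : realType} {X1 X2 : pmetricType R}.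
Local Notation X := (sum_prod X1 X2).
Local Notation XY1 := (X * X1)%type.
Local Notation X2Y := (X2 * X)%type.
Implicit Types (mu nu zeta : probability (borel X) R).

(* The target space Y = Y1 x Y2 equals X, with Y1 = X1 and Y2 = X2. A point of
   X x Y1 reads ((x1, x2), y1), a point of X2 x Y reads (x2, (y1, y2)); both
   projections below return (y1, x2), a point of Y1 x X2 = X. *)
Definition pivot_proj1 (z : XY1) : X := (z.2, z.1.2).
Definition pivot_proj2 (z : X2Y) : X := (z.2.1, z.1).

Definition cardinal_flow mu nu
    (f1 : probability (borel XY1) R) (f2 : probability (borel X2Y) R) : Prop :=
  [/\ has_image f1 (fst : borel XY1 -> borel X) mu,
      has_image f2 (snd : borel X2Y -> borel X) nu &
      forall A : set (borel X), measurable A ->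
        pushforward f1 (pivot_proj1 : borel XY1 -> borel X) A =
        pushforward f2 (pivot_proj2 : borel X2Y -> borel X) A].

Definition flow_cost
    (f1 : probability (borel XY1) R) (f2 : probability (borel X2Y) R) : \bar R :=
  (\int[f1]_z (mdist (z : XY1).1.1 (z : XY1).2)%:E +
   \int[f2]_z (mdist (z : X2Y).1 (z : X2Y).2.2)%:E)%E.

Definition optimal_flow mu nu f1 f2 : Prop :=
  cardinal_flow mu nu f1 f2 /\
  forall g1 g2, cardinal_flow mu nu g1 g2 ->
    (flow_cost f1 f2 <= flow_cost g1 g2)%E.

Definition pivot_measure mu nu zeta : Prop :=
  exists f1 f2, [/\ optimal_flow mu nu f1 f2,
    has_image f1 (pivot_proj1 : borel XY1 -> borel X) zeta &
    has_image f2 (pivot_proj2 : borel X2Y -> borel X) zeta].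

End cardinal_flows.

(* Main.v *)
(* Projecting a coupling pi of mu and nu to its coordinates ((x1, x2), y1) and
   (x2, (y1, y2)) gives a cardinal flow of the same cost as pi, and an optimal
   flow through zeta yields couplings of (mu, zeta) and (zeta, nu) whose costs
   are its two terms; by optimality, W(mu, zeta) + W(zeta, nu) <= W(mu, nu). The
   converse is the triangle inequality, for which an approximate gluing
   suffices: given couplings pi1, pi2 with common marginal zeta and a countable
   Borel partition (B_n) into sets of diameter at most e, the measure
   sum_n zeta(B_n)^-1 (pi1 x pi2) restricted to {y in B_n} x {y' in B_n} has
   marginals pi1 and pi2, and d(y, y') <= e almost everywhere, so that no
   disintegration is needed. *)
Require Import Defs.
From HB Require Import structures.
From mathcomp Require Import all_boot all_order all_algebra.
From mathcomp Require Import all_classical all_reals all_analysis.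
From mathcomp Require Import measurable_realfun lra.
Set Implicit Arguments.
Unset Strict Implicit.
Unset Printing Implicit Defensive.
Import Order.TTheory GRing.Theory Num.Theory.
Import numFieldNormedType.Exports.
Local Open Scope classical_set_scope.
Local Open Scope ring_scope.
Local Open Scope ereal_scope.

(* The library does not join the pointed and the topological structures of a
   product. *)
HB.saturate prod.

(** * Borel measurability of continuous maps *)

Lemma continuous_borel_measurable (S T : ptopologicalType) (f : S -> T) :
  continuous f -> measurable_fun [set: borel S] (f : borel S -> borel T).
Proof.
move=> /continuousP cf.
apply: (@measurability _ _ (borel S) (borel T) setT f (@open T)) => //.
by move=> _ [U oU <-]; rewrite setTI; apply: sub_sigma_algebra; exact: cf.
Qed.

Lemma measurable_fst_borel (S U : ptopologicalType) :
  measurable_fun setT (fst : borel (S * U)%type -> borel S).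
Proof. by apply: (@continuous_borel_measurable (S * U)%type S fst) => x; exact: cvg_fst. Qed.

Lemma measurable_snd_borel (S U : ptopologicalType) :
  measurable_fun setT (snd : borel (S * U)%type -> borel U).
Proof. by apply: (@continuous_borel_measurable (S * U)%type U snd) => x; exact: cvg_snd. Qed.

Lemma continuous_pair (S U V : topologicalType) (f : S -> U) (g : S -> V) :
  continuous f -> continuous g -> continuous (fun s => (f s, g s)).
Proof. by move=> cf cg s; exact: (cvg_pair (cf s) (cg s)). Qed.

(** * Continuity with respect to the sum distance *)

Section metric_continuity.
Context {R : realType}.

(** The topology of [sum_prod] is that of the sum distance, so the pairing is checked on distances:
    each of the two summands is kept below e/2. *)
Lemma continuous_sum_pair (S : topologicalType) (X1 X2 : pmetricType R)
    (f1 : S -> X1) (f2 : S -> X2) : continuous f1 -> continuous f2 ->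
  continuous (fun s => (f1 s, f2 s) : sum_prod X1 X2).
Proof.
move=> c1 c2 s; apply/metricType_numDomainType.cvgrPdist_lt => e e0; near=> t.
rewrite [ltLHS]/mdist/= /sum_dist/= [ltRHS]splitr ltrD//.
  by near: t; apply: metricType_numDomainType.cvgr_dist_lt; [exact: c1|rewrite divr_gt0].
by near: t; apply: metricType_numDomainType.cvgr_dist_lt; [exact: c2|rewrite divr_gt0].
Unshelve. all: by end_near. Qed.

(** A coordinate distance never exceeds the sum distance. *)
Lemma continuous_sum_fst (X1 X2 : pmetricType R) :
  continuous (fst : sum_prod X1 X2 -> X1).
Proof.
move=> x; apply/(@metricType_numDomainType.cvgrPdist_lt _ _ _ _ (nbhs_filter x)) => e e0.
have := @metricType_numDomainType.cvgr_dist_lt _ _ _ _ (nbhs_filter x) _ _ (@cvg_id _ (nbhs x)) _ e0.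
by apply: filterS => t; apply: le_lt_trans; rewrite lerDl mdist_ge0.
Qed.

Lemma continuous_sum_snd (X1 X2 : pmetricType R) :
  continuous (snd : sum_prod X1 X2 -> X2).
Proof.
move=> x; apply/(@metricType_numDomainType.cvgrPdist_lt _ _ _ _ (nbhs_filter x)) => e e0.
have := @metricType_numDomainType.cvgr_dist_lt _ _ _ _ (nbhs_filter x) _ _ (@cvg_id _ (nbhs x)) _ e0.
by apply: filterS => t; apply: le_lt_trans; rewrite lerDr mdist_ge0.
Qed.

Lemma continuous_mdist (S : topologicalType) (T : pmetricType R)
    (f g : S -> T) : continuous f -> continuous g ->
  continuous (fun s => mdist (f s) (g s)).
Proof.
move=> cf cg s; apply/cvgrPdist_lt => e e0; near=> t.
have ft : (mdist (f s) (f t) < e / 2)%R.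
  by near: t; apply: metricType_numDomainType.cvgr_dist_lt; [exact: cf|rewrite divr_gt0].
have gt : (mdist (g s) (g t) < e / 2)%R.
  by near: t; apply: metricType_numDomainType.cvgr_dist_lt; [exact: cg|rewrite divr_gt0].
(* Two triangle inequalities for each sign bound the variation of the distance by d(f s, f t) + d(g
   s, g t). *)
have h1 := metric_triangle (f s) (f t) (g s).
have h2 := metric_triangle (f t) (g t) (g s).
have h3 := metric_triangle (f t) (f s) (g t).
have h4 := metric_triangle (f s) (g s) (g t).
rewrite (metric_sym (g t)) in h2; rewrite (metric_sym (f t) (f s)) in h3.
rewrite ltr_distl; apply/andP; split; lra.
Unshelve. all: by end_near. Qed.

Lemma measurable_mdist (S : ptopologicalType) (T : pmetricType R)
    (f g : S -> T) : continuous f -> continuous g ->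
  measurable_fun [set: borel S] (fun s : borel S => (mdist (f s) (g s))%:E).
Proof.
move=> cf cg; apply/measurable_EFinP.
apply: (measurability _ (RGenOInfty.measurableE R)) => //.
move=> _ [_ [x ->] <-]; rewrite setTI; apply: sub_sigma_algebra.
by have /continuousP := continuous_mdist cf cg; apply; rewrite set_itvE; exact: open_gt.
Qed.

End metric_continuity.

(** * Image measures and change of variables *)

Lemma exists_image_probability d d' (S : measurableType d)
    (T : measurableType d') (R : realType) (P : probability S R) (f : S -> T) :
  measurable_fun setT f -> exists Q : probability T R, has_image P f Q.
Proof.
move=> mf; pose X : {mfun S >-> T} := mfun_Sub (mem_set mf).
by exists (distribution P X).
Qed.

Lemma has_image_integral d d' (S : measurableType d) (T : measurableType d')
    (R : realType) (m : {measure set S -> \bar R})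
    (m' : {measure set T -> \bar R}) (f : S -> T) (g : T -> \bar R) :
  measurable_fun setT f -> has_image m f m' ->
  measurable_fun setT g -> (forall t, 0 <= g t) ->
  \int[m']_t g t = \int[m]_s g (f s).
Proof.
move=> mf mm' mg g0; transitivity (\int[pushforward m f]_t g t).
  by apply: eq_measure_integral => A mA _; rewrite -mm'.
by rewrite ge0_integral_pushforward.
Qed.

(** * Borel sets of a separable metric space *)

Section separable_metric.
Context {R : realType} {T : pmetricType R}.

Lemma open_metric_ball (x : T) (e : R) : open (ball x e).
Proof.
rewrite ballEmdist -[X in open X]/((fun y => mdist x y) @^-1` [set r | r < e]%R).
have /continuousP : continuous (fun y : T => mdist x y).
  by apply: continuous_mdist => y; [exact: cvg_cst|exact: cvg_id].
by apply; exact: open_lt.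
Qed.

Lemma dense_sequence (D : set T) : countable D -> dense D ->
  exists u : nat -> T, forall x (e : R), (0 < e)%R -> exists n, ball (u n) e x.
Proof.
move=> /countable_injP[f finj] dD.
(* Indices outside the range of [f] on [D] receive the default [point]; only the indices [f y] with
   y in [D] serve below. *)
exists (fun n => xget point [set y | D y /\ f y = n]) => x e e0.
have [y [xy Dy]] : ball x e `&` D !=set0.
  apply: dD; first by exists x; exact: ballxx.
  exact: open_metric_ball.
exists (f y); have -> : xget point [set z | D z /\ f z = f y] = y.
  by case: xgetP => [z _ [Dz /finj]|/(_ y)[]//]; apply; exact/mem_set.
exact: ball_sym.
Qed.

Variable u : nat -> T.
Hypothesis u_dense : forall x (e : R), (0 < e)%R -> exists n, ball (u n) e x.

(** Separability makes every open set of T x T a countable union of boxes, hence a member of the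
    product sigma-algebra. This lets the glued measure, which lives on a product sigma-algebra, be
    pushed to the Borel sets of T x T. *)
Lemma measurable_borel_pair d (S : measurableType d) (f g : S -> borel T) :
  measurable_fun setT f -> measurable_fun setT g ->
  measurable_fun setT (fun s => (f s, g s) : borel (T * T)%type).
Proof.
move=> mf mg.
apply: (@measurability _ _ S (borel (T * T)%type) setT _ (@open (T * T)%type)) => //.
move=> _ [U oU <-]; rewrite setTI.
pose r (n : nat) : R := n.+1%:R^-1%R.
pose Q (k : nat * nat * nat) : set (T * T) :=
  ball (u k.1.1) (r k.2) `*` ball (u k.1.2) (r k.2).
have -> : (fun s => (f s, g s) : T * T) @^-1` U =
    \bigcup_k (if `[< Q k `<=` U >] then
      f @^-1` ball (u k.1.1) (r k.2) `&` g @^-1` ball (u k.1.2) (r k.2)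
      else set0).
  apply/seteqP; split=> [s Us|s [k _]]; last first.
    by case: asboolP => // QU [? ?]; exact: QU.
  have [[A B] [/= nA nB] ABU] : nbhs (f s, g s) U by exact: open_nbhs_nbhs.
  have [e1 e10 e1A] := (nbhs_ballP _ _).1 nA.
  have [e2 e20 e2B] := (nbhs_ballP _ _).1 nB.
  (* With radius below half of e1 and e2, a ball of radius [r n] that contains [f s] lies in the
     e1-ball about [f s], and likewise for [g s] and e2. *)
  have [n ne] : exists n, (r n < Num.min e1 e2 / 2)%R.
    have e0 : (0 < Num.min e1 e2 / 2)%R by rewrite divr_gt0// lt_min e10.
    by have [n _ /(_ _ (leqnn n))] := near_infty_natSinv_lt (PosNum e0); exists n.
  have r0 : (0 < r n)%R by rewrite invr_gt0.
  have [i fi] := u_dense (f s) r0; have [j gj] := u_dense (g s) r0.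
  exists (i, j, n) => //=; case: asboolP => // -[] [a b] [/= ia jb].
  apply: ABU; split => /=.
    apply: e1A => /=; apply: le_ball (ball_triangle (ball_sym fi) ia).
    by rewrite [leRHS]splitr lerD// (le_trans (ltW ne))// ler_pM2r// ge_min lexx.
  apply: e2B => /=; apply: le_ball (ball_triangle (ball_sym gj) jb).
  by rewrite [leRHS]splitr lerD// (le_trans (ltW ne))// ler_pM2r// ge_min lexx orbT.
apply: countable_bigcupT_measurable => [|k]; first exact: countableP.
case: asboolP => // _.
by apply: measurableI; rewrite -[X in measurable X]setTI; [apply: mf|apply: mg] => //;
  apply: sub_sigma_algebra; exact: open_metric_ball.
Qed.

Lemma small_partition (e : R) : (0 < e)%R -> exists B : (set (borel T))^nat,
  [/\ forall n, measurable (B n), trivIset setT B, \bigcup_n B n = setT &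
      forall n x y, B n x -> B n y -> (mdist x y <= e)%R].
Proof.
(* Balls of radius e/2 have diameter at most e, and [seqDU] only shrinks them when making them
   disjoint. *)
move=> e0; pose C n : set (borel T) := ball (u n) (e / 2).
have mC n : measurable (C n) by apply: sub_sigma_algebra; exact: open_metric_ball.
exists (seqDU C); split.
- exact: seqDU_measurable.
- exact: trivIset_seqDU.
- rewrite -seqDU_bigcup_eq -subTset => x _.
  by have [|n ?] := @u_dense x (e / 2); [rewrite divr_gt0|exists n].
- move=> n x y [Cx _] [Cy _].
  have := ball_triangle (ball_sym Cx) Cy.
  by rewrite -splitr ballEmdist => /ltW.
Qed.

End separable_metric.

(** * Gluing two measures along a countable partition *)

Lemma measure_partition d d' (S : measurableType d) (T : measurableType d')
    (R : realType) (m : {measure set S -> \bar R}) (p : S -> T)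
    (B : (set T)^nat) (A : set S) :
  measurable_fun setT p -> (forall n, measurable (B n)) -> trivIset setT B ->
  \bigcup_n B n = setT -> measurable A ->
  m A = \sum_(n <oo) m (A `&` p @^-1` B n).
Proof.
move=> mp mB tB coverB mA.
have mpB n : measurable (p @^-1` B n) by rewrite -[X in measurable X]setTI; exact: mp.
rewrite -[in LHS](setIT A) -[in LHS](preimage_setT p) -coverB.
rewrite preimage_bigcup setI_bigcupr measure_semi_bigcup//.
- by move=> n; exact: measurableI.
- apply: trivIset_setIl => i j _ _ [x [Bi Bj]].
  by apply: tB => //; exists (p x).
- by apply: bigcup_measurable => n _; exact: measurableI.
Qed.

Section gluing.
Context d1 d2 d (S1 : measurableType d1) (S2 : measurableType d2)
  (T : measurableType d) (R : realType).
Variables (P1 : probability S1 R) (P2 : probability S2 R).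
Variables (p1 : S1 -> T) (p2 : S2 -> T).
Hypotheses (mp1 : measurable_fun setT p1) (mp2 : measurable_fun setT p2).
Hypothesis P12 : forall B, measurable B -> P1 (p1 @^-1` B) = P2 (p2 @^-1` B).
Variable B : (set T)^nat.
Hypotheses (mB : forall n, measurable (B n)) (tB : trivIset setT B)
  (coverB : \bigcup_n B n = setT).

Let E1 n : set S1 := p1 @^-1` B n.
Let E2 n : set S2 := p2 @^-1` B n.

Let mE1 n : measurable (E1 n).
Proof. by rewrite -[E1 n]setTI; exact: mp1. Qed.

Let mE2 n : measurable (E2 n).
Proof. by rewrite -[E2 n]setTI; exact: mp2. Qed.

Let inv_mass_ge0 n : (0 <= (fine (P2 (E2 n)))^-1)%R.
Proof. by rewrite invr_ge0 fine_ge0. Qed.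

(* [0^-1 = 0], so the blocks of null mass contribute nothing. *)
Let weight n : {nonneg R} := NngNum (inv_mass_ge0 n).

(** The weight cancels the mass of its block. On a null block the bound on x forces x = 0, so the
    identity survives there too. *)
Let weightK n x : 0 <= x <= P2 (E2 n) ->
  (weight n)%:num%:E * (x * P2 (E2 n)) = x.
Proof.
move=> /andP[x0 xE].
have Ef : P2 (E2 n) \is a fin_num by exact: fin_num_measure.
have [E0|E0] := eqVneq (P2 (E2 n)) 0.
  by rewrite E0 !mule0; apply/eqP; rewrite eq_le x0 -E0 xE.
by rewrite muleCA -[X in _ * (_ * X)](fineK Ef) -EFinM /= mulVf ?mule1// fine_eq0.
Qed.

(** Conditionally on the block, the two points are independent, each following its own measure
    restricted to that block. *)
Let Q : set (S1 * S2) -> \bar R :=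
  mseries (fun n => mscale (weight n)
    (mrestr (P1 \x P2) (measurableX (mE1 n) (mE2 n)))) 0.

HB.instance Definition _ := Measure.on Q.

Let Q_fst A : measurable A -> Q (fst @^-1` A) = P1 A.
Proof.
move=> mA; rewrite [RHS](measure_partition _ mp1 mB)//.
apply: eq_eseriesr => n _.
rewrite -[LHS]/(_ * (P1 \x P2) (fst @^-1` A `&` E1 n `*` E2 n)).
rewrite (_ : _ `&` _ = (A `&` E1 n) `*` E2 n); last first.
  by apply/seteqP; split=> -[s1 s2] /=; tauto.
rewrite product_measure1E//; last exact: measurableI.
(* The bound required is P1(A and E1 n) <= P1(E1 n) = P2(E2 n). *)
apply: weightK; rewrite measure_ge0/= -P12//.
apply: le_measure; rewrite ?inE; [exact: measurableI|exact: mE1|exact: subIsetr].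
Qed.

Let Q_snd A : measurable A -> Q (snd @^-1` A) = P2 A.
Proof.
move=> mA; rewrite [RHS](measure_partition _ mp2 mB)//.
apply: eq_eseriesr => n _.
rewrite -[LHS]/(_ * (P1 \x P2) (snd @^-1` A `&` E1 n `*` E2 n)).
rewrite (_ : _ `&` _ = E1 n `*` (A `&` E2 n)); last first.
  by apply/seteqP; split=> -[s1 s2] /=; tauto.
rewrite product_measure1E//; last exact: measurableI.
(* The factor to cancel is now P1(E1 n), which equals P2(E2 n) because the projections have the same
   law. *)
transitivity ((weight n)%:num%:E * (P2 (A `&` E2 n) * P2 (E2 n))).
  by congr (_ * _); rewrite muleC; congr (_ * _); exact: P12.
apply: weightK; rewrite measure_ge0/=.
apply: le_measure; rewrite ?inE; [exact: measurableI|exact: mE2|exact: subIsetr].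
Qed.

Let Q_setT : Q setT = 1.
Proof. by rewrite -(preimage_setT fst) Q_fst// probability_setT. Qed.

HB.instance Definition _ := Measure_isProbability.Build _ _ _ Q Q_setT.

(** The last clause holds because [Q] is carried by the blocks [E1 n] x [E2 n]: a set that meets
    none of them is null. *)
Lemma exists_block_gluing : exists Q : probability (S1 * S2)%type R,
  [/\ has_image Q fst P1, has_image Q snd P2 &
      forall N, measurable N ->
        (forall n s1 s2, B n (p1 s1) -> B n (p2 s2) -> ~ N (s1, s2)) -> Q N = 0].
Proof.
exists Q; split=> // N mN NB.
apply: eseries0 => n _ _.
rewrite -[LHS]/(_ * (P1 \x P2) (N `&` E1 n `*` E2 n)).
rewrite (_ : N `&` _ = set0) ?measure0 ?mule0//.
by apply/seteqP; split=> // -[s1 s2] [Ns [Bs1 Bs2]]; exact: (NB n _ _ Bs1 Bs2 Ns).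
Qed.

End gluing.

(** * The triangle inequality for the Wasserstein cost *)

Section wasserstein_triangle.
Context {R : realType} {T : pmetricType R}.
Implicit Types mu nu zeta : probability (borel T) R.

Let cost (z : borel (T * T)%type) : \bar R := (mdist (z : T * T).1 (z : T * T).2)%:E.

Let measurable_cost : measurable_fun setT cost.
Proof. by apply: (@measurable_mdist _ (T * T)%type T fst snd) => x; [exact: cvg_fst|exact: cvg_snd]. Qed.

Let cost_ge0 z : 0 <= cost z.
Proof. by rewrite lee_fin mdist_ge0. Qed.

Lemma wasserstein_ge0 mu nu : 0 <= wasserstein mu nu.
Proof. by apply: le_ereal_inf_tmp => _ [pi _ <-]; apply: integral_ge0 => z _; exact: cost_ge0. Qed.

Lemma wasserstein_le_cost mu nu (pi : probability (borel (T * T)%type) R) :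
  coupling mu nu pi -> wasserstein mu nu <= \int[pi]_z cost z.
Proof. by move=> Cpi; apply: ereal_inf_lbound; exists pi. Qed.

(** The law of [f] under P is a coupling, so upper bounds can be computed on any convenient space:
    the glued product or a component of a flow. *)
Lemma wasserstein_le_image d (S : measurableType d) (P : probability S R)
    (f : S -> borel (T * T)%type) mu nu : measurable_fun setT f ->
  has_image P (fun s => (f s).1 : borel T) mu ->
  has_image P (fun s => (f s).2 : borel T) nu ->
  wasserstein mu nu <= \int[P]_s cost (f s).
Proof.
move=> mf Pmu Pnu; have [pi Ppi] := exists_image_probability P mf.
rewrite -(has_image_integral mf Ppi)//; apply: wasserstein_le_cost.
split=> A mA; rewrite -?Pmu -?Pnu// /pushforward -Ppi//.
  by rewrite -[X in measurable X]setTI; exact: measurable_fst_borel.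
by rewrite -[X in measurable X]setTI; exact: measurable_snd_borel.
Qed.

Variable u : nat -> T.
Hypothesis u_dense : forall x (e : R), (0 < e)%R -> exists n, ball (u n) e x.

(** Under a gluing of mesh e, points ((x, y), (y', z)) satisfy d(x, z) <= d(x, y) + d(y', z) + e
    almost everywhere, and (x, z) couples mu and nu. *)
Lemma wasserstein_le_costD mu zeta nu (pi1 pi2 : probability (borel (T * T)%type) R)
    (e : R) : coupling mu zeta pi1 -> coupling zeta nu pi2 -> (0 < e)%R ->
  wasserstein mu nu <= \int[pi1]_z cost z + \int[pi2]_z cost z + e%:E.
Proof.
move=> [pi1mu pi1zeta] [pi2zeta pi2nu] e0.
have [B [mB tB coverB smallB]] := small_partition u_dense e0.
have [|Q [Qpi1 Qpi2 Qnear]] := @exists_block_gluing _ _ _ _ _ _ _ pi1 pi2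
    _ _ (@measurable_snd_borel T T) (@measurable_fst_borel T T) _ B mB tB coverB.
  by move=> A mA; rewrite [LHS]pi1zeta// [RHS]pi2zeta.
pose S := (borel (T * T)%type * borel (T * T)%type)%type.
have m11 : measurable_fun setT (fun s : S => s.1.1 : borel T).
  exact: measurableT_comp (@measurable_fst_borel T T) measurable_fst.
have m12 : measurable_fun setT (fun s : S => s.1.2 : borel T).
  exact: measurableT_comp (@measurable_snd_borel T T) measurable_fst.
have m21 : measurable_fun setT (fun s : S => s.2.1 : borel T).
  exact: measurableT_comp (@measurable_fst_borel T T) measurable_snd.
have m22 : measurable_fun setT (fun s : S => s.2.2 : borel T).
  exact: measurableT_comp (@measurable_snd_borel T T) measurable_snd.
have mpair (f g : S -> borel T) : measurable_fun setT f -> measurable_fun setT g ->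
    measurable_fun setT (fun s => cost (f s, g s)).
  move=> mf mg; apply: (measurableT_comp measurable_cost).
  exact: (measurable_borel_pair u_dense mf mg).
have mc1 : measurable_fun setT (fun s : S => cost s.1).
  exact: measurableT_comp measurable_cost measurable_fst.
have mc2 : measurable_fun setT (fun s : S => cost s.2).
  exact: measurableT_comp measurable_cost measurable_snd.
(* The marginals of [Q] and its total mass 1 turn the right-hand side into one integral. *)
have -> : \int[pi1]_z cost z + \int[pi2]_z cost z + e%:E =
    \int[Q]_s (cost s.1 + cost s.2 + e%:E).
  have c1 s : 0 <= cost s.1 + cost s.2 by rewrite adde_ge0.
  have e1 : 0 <= e%:E by rewrite lee_fin ltW.
  rewrite (ge0_integralD _ _ (f1 := fun s => cost s.1 + cost s.2))//; last first.
    exact: emeasurable_funD.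
  have -> : \int[Q]_s e%:E = e%:E.
    by rewrite integral_cst// [X in _ * X](probability_setT Q) mule1.
  rewrite ge0_integralD//.
  rewrite (has_image_integral measurable_fst Qpi1)//.
  by rewrite (has_image_integral measurable_snd Qpi2).
apply: le_trans (wasserstein_le_image (P := Q) (measurable_borel_pair u_dense m11 m22) _ _) _.
- move=> A mA; apply: etrans (pi1mu _ mA); apply: (Qpi1 (fst @^-1` A)).
  by rewrite -[X in measurable X]setTI; exact: measurable_fst_borel.
- move=> A mA; apply: etrans (pi2nu _ mA); apply: (Qpi2 (snd @^-1` A)).
  by rewrite -[X in measurable X]setTI; exact: measurable_snd_borel.
(* Exceptional set where d(y, y') > e. It meets no block, since there y and y' share a piece of
   diameter at most e. *)
pose N := [set s : S | e%:E < cost (s.1.2, s.2.1)].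
have mN : measurable N.
  rewrite -[N]setTI; apply: emeasurable_fun_o_infty => //; exact: mpair.
apply: ae_ge0_le_integral => //.
- exact: mpair.
- by move=> s _; rewrite !adde_ge0// lee_fin ltW.
- by apply: emeasurable_funD => //; exact: emeasurable_funD.
exists N; split => //.
- apply: Qnear => // n [x y] [y' z] /= By By'.
  by rewrite /N /cost /= lte_fin => /lt_geF; rewrite (smallB n).
(* Off [N], the triangle inequality through y and y' gives the pointwise bound. *)
- move=> [[x y] [y' z]] /= H; rewrite /N /= ltNge; apply/negP => yy'; apply: H => _.
  move: yy'; rewrite /cost -!EFinD !lee_fin /= => yy'.
  have := metric_triangle x y z; have := metric_triangle y y' z.
  lra.
Qed.

Lemma wasserstein_triangle zeta mu nu :
  wasserstein mu nu <= wasserstein mu zeta + wasserstein zeta nu.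
Proof.
have W1 := wasserstein_ge0 mu zeta; have W2 := wasserstein_ge0 zeta nu.
(* If one term is infinite, so is the sum, the other term being nonnegative. *)
have [->|f1] := eqVneq (wasserstein mu zeta) +oo.
  by rewrite addye ?leey// -ltNye (lt_le_trans _ W2).
have [->|f2] := eqVneq (wasserstein zeta nu) +oo.
  by rewrite addey ?leey// -ltNye (lt_le_trans _ W1).
have {}f1 : wasserstein mu zeta \is a fin_num by rewrite ge0_fin_numE// ltey.
have {}f2 : wasserstein zeta nu \is a fin_num by rewrite ge0_fin_numE// ltey.
(* One third of e for each near-optimal coupling and one for the mesh of the gluing. *)
apply/lee_addgt0Pr => e e0; have e3 : (0 < e / 3)%R by rewrite divr_gt0.
have [_ [pi1 C1 <-] c1] := lb_ereal_inf_adherent e3 f1.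
have [_ [pi2 C2 <-] c2] := lb_ereal_inf_adherent e3 f2.
apply: le_trans (wasserstein_le_costD C1 C2 e3) _.
apply: (@le_trans _ _ ((wasserstein mu zeta + (e / 3)%:E) +
  (wasserstein zeta nu + (e / 3)%:E) + (e / 3)%:E)).
  by rewrite leeD2r// leeD// ltW.
rewrite addeACA -EFinD -[leLHS]addeA -EFinD leeD2l// lee_fin; lra.
Qed.

End wasserstein_triangle.

(** * Passing between couplings and cardinal flows *)

Section coupling_flow.
Context {R : realType} {X1 X2 : pmetricType R}.
Local Notation X := (sum_prod X1 X2).
Local Notation XY1 := (X * X1)%type.
Local Notation X2Y := (X2 * X)%type.
Implicit Types mu nu zeta : probability (borel X) R.

Let flow_map1 (z : X * X) : XY1 := (z.1, z.2.1).
Let flow_map2 (z : X * X) : X2Y := (z.1.2, z.2).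
(** The first move, from (x1, x2) to (y1, x2), keeps x2; the second, from (y1, x2) to (y1, y2),
    keeps y1. Each therefore costs a single summand of the sum distance. *)
Let pivot_map1 (z : XY1) : X * X := (z.1, pivot_proj1 z).
Let pivot_map2 (z : X2Y) : X * X := (pivot_proj2 z, z.2).

Let continuous_fst_fst : continuous (fun z : XY1 => z.1.1).
Proof. by move=> z; apply: continuous_comp; [exact: cvg_fst|exact: continuous_sum_fst]. Qed.

Let continuous_fst_snd : continuous (fun z : XY1 => z.1.2).
Proof. by move=> z; apply: continuous_comp; [exact: cvg_fst|exact: continuous_sum_snd]. Qed.

Let continuous_snd_fst : continuous (fun z : X2Y => z.2.1).
Proof. by move=> z; apply: continuous_comp; [exact: cvg_snd|exact: continuous_sum_fst]. Qed.

Let continuous_snd_snd : continuous (fun z : X2Y => z.2.2).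
Proof. by move=> z; apply: continuous_comp; [exact: cvg_snd|exact: continuous_sum_snd]. Qed.

Let continuous_pivot_proj1 : continuous (@pivot_proj1 R X1 X2).
Proof. by apply: continuous_sum_pair => // z; exact: cvg_snd. Qed.

Let continuous_pivot_proj2 : continuous (@pivot_proj2 R X1 X2).
Proof. by apply: continuous_sum_pair => // z; exact: cvg_fst. Qed.

Let continuous_flow_map1 : continuous flow_map1.
Proof.
apply: continuous_pair => z; first exact: cvg_fst.
by apply: (@continuous_comp (X * X)%type X X1 snd fst); [exact: cvg_snd|exact: continuous_sum_fst].
Qed.

Let continuous_flow_map2 : continuous flow_map2.
Proof.
apply: continuous_pair => z; last exact: cvg_snd.
by apply: (@continuous_comp (X * X)%type X X2 fst snd); [exact: cvg_fst|exact: continuous_sum_snd].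
Qed.

Let continuous_pivot_map1 : continuous pivot_map1.
Proof. by apply: continuous_pair => // z; exact: cvg_fst. Qed.

Let continuous_pivot_map2 : continuous pivot_map2.
Proof. by apply: continuous_pair => // z; exact: cvg_snd. Qed.

Lemma wasserstein_le_flow1 mu zeta (f1 : probability (borel XY1) R) :
  has_image f1 (fst : borel XY1 -> borel X) mu ->
  has_image f1 (@pivot_proj1 R X1 X2 : borel XY1 -> borel X) zeta ->
  wasserstein mu zeta <= \int[f1]_z (mdist (z : XY1).1.1 (z : XY1).2)%:E.
Proof.
move=> f1mu f1zeta.
apply: le_trans (wasserstein_le_image (continuous_borel_measurable continuous_pivot_map1) f1mu f1zeta) _.
rewrite le_eqVlt; apply/orP; left; apply/eqP; apply: eq_integral => z _.
by rewrite [mdist _ _ in LHS]/mdist/= /sum_dist/= mdistxx addr0.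
Qed.

Lemma wasserstein_le_flow2 zeta nu (f2 : probability (borel X2Y) R) :
  has_image f2 (@pivot_proj2 R X1 X2 : borel X2Y -> borel X) zeta ->
  has_image f2 (snd : borel X2Y -> borel X) nu ->
  wasserstein zeta nu <= \int[f2]_z (mdist (z : X2Y).1 (z : X2Y).2.2)%:E.
Proof.
move=> f2zeta f2nu.
apply: le_trans (wasserstein_le_image (continuous_borel_measurable continuous_pivot_map2) f2zeta f2nu) _.
rewrite le_eqVlt; apply/orP; left; apply/eqP; apply: eq_integral => z _.
by rewrite [mdist _ _ in LHS]/mdist/= /sum_dist/= mdistxx add0r.
Qed.

Lemma flow_of_coupling mu nu (pi : probability (borel (X * X)%type) R) :
  coupling mu nu pi -> exists g1 g2, cardinal_flow mu nu g1 g2 /\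
    flow_cost g1 g2 = \int[pi]_z (mdist (z : X * X).1 (z : X * X).2)%:E.
Proof.
move=> [pimu pinu].
have mf1 := continuous_borel_measurable continuous_flow_map1.
have mf2 := continuous_borel_measurable continuous_flow_map2.
have [g1 pig1] := exists_image_probability pi mf1.
have [g2 pig2] := exists_image_probability pi mf2.
exists g1, g2; split; first split.
- move=> A mA; rewrite -pimu// /pushforward -pig1//.
  by rewrite -[X in measurable X]setTI; exact: measurable_fst_borel.
- move=> A mA; rewrite -pinu// /pushforward -pig2//.
  by rewrite -[X in measurable X]setTI; exact: measurable_snd_borel.
(* Both sides are the mass under [pi] of the same event, that (y1, x2) lies in A. *)
- move=> A mA; rewrite /pushforward -pig1 -?pig2//.
  + rewrite -[X in measurable X]setTI.
    exact: (continuous_borel_measurable continuous_pivot_proj2).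
  + rewrite -[X in measurable X]setTI.
    exact: (continuous_borel_measurable continuous_pivot_proj1).
have mc1 : measurable_fun setT (fun z : borel XY1 => (mdist (z : XY1).1.1 (z : XY1).2)%:E).
  by apply: measurable_mdist => // z; exact: cvg_snd.
have mc2 : measurable_fun setT (fun z : borel X2Y => (mdist (z : X2Y).1 (z : X2Y).2.2)%:E).
  by apply: measurable_mdist => // z; exact: cvg_fst.
rewrite /flow_cost (has_image_integral mf1 pig1)//; last by move=> z; rewrite lee_fin mdist_ge0.
rewrite (has_image_integral mf2 pig2)//; last by move=> z; rewrite lee_fin mdist_ge0.
(* Back on the space of [pi], the two integrands add up to the sum distance. *)
rewrite -ge0_integralD//.
- by move=> z _; rewrite lee_fin mdist_ge0.
- exact: measurableT_comp mc1 mf1.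
- by move=> z _; rewrite lee_fin mdist_ge0.
- exact: measurableT_comp mc2 mf2.
Qed.

End coupling_flow.

Theorem theorem7 (R : realType) (X1 X2 : pmetricType R)
    (hX : polish_metric (sum_prod X1 X2))
    (mu nu : probability (borel (sum_prod X1 X2)) R)
    (zeta : probability (borel (sum_prod X1 X2)) R)
    (hzeta : pivot_measure mu nu zeta) :
  wasserstein mu nu = wasserstein mu zeta + wasserstein zeta nu.
Proof.
have [[D cD dD] _] := hX; have [u u_dense] := dense_sequence cD dD.
apply: le_anti; rewrite (wasserstein_triangle u_dense)//=.
have [f1 [f2 [[[f1mu f2nu _] f_opt] f1zeta f2zeta]]] := hzeta.
(* The optimal flow cost separates the two sides: its terms bound the two distances to zeta. *)
apply: le_trans (_ : flow_cost f1 f2 <= _).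
  apply: leeD; first exact: wasserstein_le_flow1.
  exact: wasserstein_le_flow2.
(* Every coupling yields a competing flow of equal cost, so the optimal cost is a lower bound for
   the infimum. *)
apply: le_ereal_inf_tmp => _ [pi [pimu pinu] <-].
have [g1 [g2 [fg <-]]] := flow_of_coupling (conj pimu pinu).
exact: f_opt.
Qed.
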